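(* For every positive integer $n$, $$\overline{A}_5(n)\equiv (-1)^n\, r_4(n) \pmod{5},$$ that is, $\overline{A}_5(n)\equiv r_4(n) \pmod 5$ if $n$ is even and $\overline{A}_5(n)\equiv -r_4(n) \pmod 5$ if $n$ is odd.
   Context: An overpartition of $n$ is a partition of $n$ (a nonincreasing sequence of positive integers summing to $n$) in which the first occurrence of each distinct part may be overlined. For a positive integer $\ell$, $\overline{A}_\ell(n)$ denotes the number of overpartitions of $n$ into parts not divisible by $\ell$ ($\ell$-regular overpartitions), with $\overline{A}_\ell(0)=1$; equivalently $$\sum_{n\ge 0}\overline{A}_\ell(n)q^n=\frac{(q^\ell;q^\ell)_\infty^2(q^2;q^2)_\infty}{(q;q)_\infty^2(q^{2\ell};q^{2\ell})_\infty},\qquad (a;q)_\infty=\prod_{k\ge 0}(1-aq^k).$$ $r_k(n)$ denotes the number of representations of $n$ as a sum of $k$ squares of integers, i.e. the number of $(x_1,\dots,x_k)\in\mathbb{Z}^k$ with $x_1^2+\cdots+x_k^2=n$. *)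

(* Defs.v *)
From HB Require Import structures.
From mathcomp Require Export all_boot all_order all_algebra.

Set Implicit Arguments.
Unset Strict Implicit.
Unset Printing Implicit Defensive.

Import Order.TTheory GRing.Theory Num.Theory.

(* An overpartition is the sequence of its parts, each carrying a flag telling
   whether it is overlined. The last condition says that an overlined part is
   never preceded by an equal part. *)
Definition is_overpartition (n : nat) (s : seq (nat * bool)) : bool :=
  [&& all (fun p => 0 < p.1) s,
      sorted geq (unzip1 s),
      sumn (unzip1 s) == n
    & pairwise (fun p q => (p.1 == q.1) ==> ~~ q.2) s].

Definition is_regular_overpartition (l n : nat) (s : seq (nat * bool)) : bool :=
  is_overpartition n s && all (fun p => ~~ (l %| p.1)) s.

(* Overpartitions of n have at most n parts, all at most n, so they are counted
   inside this finite type; no overpartition is lost, see Abar_adequate. *)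
Definition bounded_seq (n : nat) : finType :=
  {k : 'I_n.+1 & k.-tuple ('I_n.+1 * bool)}.

Definition seq_of_bounded (n : nat) (s : bounded_seq n) : seq (nat * bool) :=
  [seq (val p.1, p.2) | p <- val (tagged s)].

Definition Abar (l n : nat) : nat :=
  #|[set s : bounded_seq n | is_regular_overpartition l n (seq_of_bounded s)]|.

(* The integer solutions of x_1^2 + ... + x_k^2 = n lie in [-n, n]^k; the
   ordinal x i stands for the integer x i - n. See repr_squares_adequate. *)
Definition shift_int (k n : nat) (x : {ffun 'I_k -> 'I_(n + n).+1}) :
    {ffun 'I_k -> int} := [ffun i => ((x i)%:Z - n%:Z)%R].

Definition is_square_repr (k n : nat) (x : {ffun 'I_k -> int}) : bool :=
  (\sum_i x i ^+ 2 == n%:Z)%R.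

Definition repr_squares (k n : nat) : nat :=
  #|[set x : {ffun 'I_k -> 'I_(n + n).+1} | is_square_repr n (shift_int x)]|.

Lemma seq_of_bounded_inj n : injective (@seq_of_bounded n).
Proof.
case=> [k s] [k' s']; rewrite /seq_of_bounded /= => E.
have Ek : k = k'.
  apply: val_inj => /=.
  by rewrite -(size_tuple s) -(size_tuple s') -(size_map (fun p => (val p.1, p.2))) E size_map.
case: _ / Ek s' E => s' E; congr Tagged; apply: val_inj.
by apply: inj_map E => -[a b] [a' b'] [/val_inj -> ->].
Qed.

Lemma is_overpartition_bounded n s :
  is_overpartition n s -> exists t : bounded_seq n, seq_of_bounded t = s.
Proof.
case/and4P=> pos _ /eqP sn _.
have [szs les] : size s <= n /\ all (fun p => p.1 < n.+1) s.
  elim: s n pos sn => [|p s IH] n //= /andP[p0 pos] sn.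
  have [h1 h2] := IH _ pos erefl; rewrite -sn; split.
    by rewrite -add1n leq_add.
  rewrite ltnS leq_addr /=; apply: sub_all h2 => q; rewrite !ltnS => h.
  exact: leq_trans h (leq_addl _ _).
pose f (p : nat * bool) := (inord p.1 : 'I_n.+1, p.2).
have hs : size (map f s) == Ordinal (szs : size s < n.+1) by rewrite size_map.
exists (Tagged (fun k : 'I_n.+1 => k.-tuple ('I_n.+1 * bool)%type) (Tuple hs)).
rewrite /seq_of_bounded /= -map_comp -[RHS]map_id; apply/eq_in_map => -[a b] hab /=.
by rewrite inordK //; have := allP les _ hab.
Qed.

Lemma Abar_adequate l n : exists r : seq (seq (nat * bool)),
  [/\ uniq r, forall s, (s \in r) = is_regular_overpartition l n s
    & Abar l n = size r].
Proof.
set S := [set s : bounded_seq n | is_regular_overpartition l n (seq_of_bounded s)].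
exists (map (@seq_of_bounded n) (enum S)); split.
- by rewrite (map_inj_uniq (@seq_of_bounded_inj n)) enum_uniq.
- move=> s; apply/mapP/idP => [[t]|h]; first by rewrite mem_enum inE => h ->.
  have [t ts] := is_overpartition_bounded (proj1 (andP h)).
  by exists t; rewrite // mem_enum inE ts.
- by rewrite size_map -cardE.
Qed.

Lemma repr_squares_adequate k n : exists r : seq {ffun 'I_k -> int},
  [/\ uniq r, forall x, (x \in r) = is_square_repr n x
    & repr_squares k n = size r].
Proof.
set S := [set x : {ffun 'I_k -> 'I_(n + n).+1} | is_square_repr n (shift_int x)].
exists (map (@shift_int k n) (enum S)); split.
- rewrite map_inj_uniq ?enum_uniq // => x y /ffunP E; apply/ffunP => i.
  by have := E i; rewrite !ffunE => /addIr [] /val_inj.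
- move=> x; apply/mapP/idP => [[t]|h]; first by rewrite mem_enum inE => h ->.
  have bd i : (`|x i| <= n%:Z)%R.
    have le2 : (x i ^+ 2 <= n%:Z)%R.
      rewrite -(eqP h) (bigD1 i) //= lerDl; apply: sumr_ge0 => j _.
      exact: sqr_ge0.
    apply: le_trans le2; rewrite -real_normK ?num_real //.
    by case: `|x i|%R (normr_ge0 (x i)) => // -[|m] _ //; rewrite expr2 ler_peMl.
  pose t : {ffun 'I_k -> 'I_(n + n).+1} := [ffun i => inord `|(x i + n%:Z)%R|%N].
  have xt : x = shift_int t.
    apply/ffunP => i; rewrite !ffunE.
    have := bd i; rewrite ler_norml => /andP[lo hi].
    have ge0 : (0 <= x i + n%:Z)%R by rewrite -lerBlDr sub0r.
    rewrite inordK ?gez0_abs ?addrK // ltnS -lez_nat gez0_abs // PoszD.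
    by rewrite lerD2r.
  by exists t; rewrite // mem_enum inE -xt.
- by rewrite size_map -cardE.
Qed.

(* Main.v *)
Require Import Defs.
From mathcomp Require Import all_boot all_order all_algebra.
From mathcomp Require Import ring zify.

Set Implicit Arguments.
Unset Strict Implicit.
Unset Printing Implicit Defensive.

Import GRing.Theory.

(** Write E = prod (1 - q^i), O = prod (1 + q^i), and E', O' (resp. E'', O'')
for the subproducts over i prime to 5 (resp. divisible by 5). Removing the
largest part of an overpartition shows that the generating function A of the
5-regular overpartitions satisfies A E' = O'. Modulo 5 the Frobenius morphism
gives E'' = E^5 and O'' = O^5, hence A = (E / O)^4. By Gauss' identity E / O is
the theta series sum_(k in Z) (-1)^k q^(k^2), whose fourth power has
coefficients (-1)^n r_4(n). Gauss' identity is the limit of a finite identity in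
the style of Shanks, proved by telescoping. All series are truncated:
polynomials modulo X^(N+1). *)

(** * Counting overpartitions by their largest part *)

Definition bounded_seqs (n : nat) : seq (seq (nat * bool)) :=
  [seq seq_of_bounded s | s <- enum (bounded_seq n)].

Lemma bounded_seqs_uniq n : uniq (bounded_seqs n).
Proof. by rewrite (map_inj_uniq (@seq_of_bounded_inj n)) enum_uniq. Qed.

Lemma mem_bounded_seqs n s : is_overpartition n s -> s \in bounded_seqs n.
Proof.
by case/is_overpartition_bounded=> t <-; rewrite map_f // mem_enum.
Qed.

(** [bounded_seqs] lists every overpartition without repetition, so both counts are sizes of full
    extents, and prepending [x] is a bijection between them. *)
Lemma count_bounded_seqs_cons n n' x (P P' : pred (seq (nat * bool))) :
  (forall s, P s -> is_overpartition n s) ->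
  (forall s, P' s -> is_overpartition n' s) ->
  (forall s, P s = if s is p :: t then (p == x) && P' t else false) ->
  count P (bounded_seqs n) = count P' (bounded_seqs n').
Proof.
move=> Pn Pn' PE; rewrite -!size_filter -[RHS](size_map (cons x)).
apply/perm_size/uniq_perm.
- by rewrite filter_uniq ?bounded_seqs_uniq.
- by rewrite map_inj_uniq ?filter_uniq ?bounded_seqs_uniq // => s t [].
move=> s; rewrite mem_filter.
have -> : P s && (s \in bounded_seqs n) = P s.
  by case Ps: (P s); rewrite // mem_bounded_seqs ?Pn.
rewrite PE; case: s => [|p t]; first by apply/esym/mapP => -[].
apply/andP/mapP => [[/eqP-> Pt]|[u]].
  by exists t; rewrite // mem_filter Pt mem_bounded_seqs ?Pn'.
by rewrite mem_filter => /andP[Pu _] [-> ->].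
Qed.

Definition bounded_overpartition (l M n : nat) (s : seq (nat * bool)) : bool :=
  is_regular_overpartition l n s && all (fun p => p.1 <= M) s.

(* Only the largest admissible part M must not be overlined. *)
Definition underlined_overpartition (l M n : nat) (s : seq (nat * bool)) : bool :=
  bounded_overpartition l M n s && ((M, true) \notin s).

Lemma bounded_overpartition_overpartition l M n s :
  bounded_overpartition l M n s -> is_overpartition n s.
Proof. by case/andP=> /andP[]. Qed.

(** Whatever the flag [b], a leading [M] forbids exactly the later occurrences of [(M, true)]; this
    is what makes the underlined variant appear. *)
Lemma bounded_overpartition_cons l M n b t : 0 < M -> ~~ (l %| M) ->
  bounded_overpartition l M n ((M, b) :: t)
  = (M <= n) && underlined_overpartition l M (n - M) t.
Proof.
move=> M0 lM; rewrite /underlined_overpartition /bounded_overpartition.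
rewrite /is_regular_overpartition /is_overpartition /= M0 lM leqnn /=.
rewrite (path_sortedE (rev_trans leq_trans)) all_map.
rewrite [all (preim _ _) t](@eq_all _ _ (fun p => p.1 <= M)) //.
have -> : all (fun q : nat * bool => (M == q.1) ==> ~~ q.2) t = ((M, true) \notin t).
  rewrite -has_pred1 -all_predC; apply: eq_all => -[x c] /=.
  by rewrite xpair_eqE [x == M]eq_sym; case: (M == x); case: c.
have -> : (M + sumn (unzip1 t) == n) = (M <= n) && (sumn (unzip1 t) == n - M) by lia.
case: (all (fun p : nat * bool => p.1 <= M) t); last by rewrite !(andbF, andFb).
rewrite /= ?andbT.
by rewrite -!andbA; do !bool_congr.
Qed.

(** Parts are nonincreasing, so the head alone decides whether [M.+1] occurs. The default head 0
    differs from [M.+1] and covers the empty sequence. *)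
Lemma bounded_overpartitionS l M n s :
  bounded_overpartition l M n s
  = bounded_overpartition l M.+1 n s && ~~ (head 0 (unzip1 s) == M.+1).
Proof.
rewrite /bounded_overpartition /is_regular_overpartition /is_overpartition.
case: s => [|[x b] t] /=; first by rewrite !andbT.
rewrite (path_sortedE (rev_trans leq_trans)) all_map.
case E: (all _ t && sorted _ _); last by rewrite !(andbF, andFb).
have -> : (x <= M) = (x <= M.+1) && (x != M.+1) by lia.
have -> : (x <= M.+1) && (x != M.+1) && all (fun p : nat * bool => p.1 <= M) t
   = ((x <= M.+1) && all (fun p : nat * bool => p.1 <= M.+1) t) && (x != M.+1).
  case: eqVneq => [->|xM]; first by rewrite !andbF.
  rewrite !andbT; case: leqP => //= xleM; case/andP: E => /allP/= E _.
  by apply: eq_in_all => p /E; lia.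
by rewrite -!andbA.
Qed.

Lemma underlined_overpartition_cons l M n b t : 0 < M -> ~~ (l %| M) ->
  underlined_overpartition l M n ((M, b) :: t)
  = [&& ~~ b, M <= n & underlined_overpartition l M (n - M) t].
Proof.
move=> M0 lM; rewrite {1}/underlined_overpartition bounded_overpartition_cons //.
rewrite in_cons xpair_eqE eqxx /= /underlined_overpartition.
by case: b; case: (_ \in t); rewrite !(andbF, andbT).
Qed.

Lemma bounded_overpartition_notin l M n s b :
  bounded_overpartition l M n s -> (M.+1, b) \notin s.
Proof.
by case/andP=> _ /allP le_sM; apply/negP => /le_sM; rewrite /= ltnn.
Qed.

Definition num_bounded l M n :=
  count (bounded_overpartition l M n) (bounded_seqs n).
Definition num_underlined l M n :=
  count (underlined_overpartition l M n) (bounded_seqs n).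

(** Split on whether the head is [M.+1]. Such a head is not overlined, and removing it leaves a
    sequence of the same kind. *)
Lemma num_underlinedS l M n : ~~ (l %| M.+1) ->
  num_underlined l M.+1 n
  = num_bounded l M n + (if M < n then num_underlined l M.+1 (n - M.+1) else 0).
Proof.
move=> lM; rewrite /num_underlined.
rewrite -size_filter -(count_predC (fun s => head 0 (unzip1 s) == M.+1)).
rewrite addnC !count_filter; congr (_ + _).
  apply: eq_count => s; rewrite [RHS]bounded_overpartitionS /=.
  rewrite /underlined_overpartition.
  case: (boolP (head 0 _ == _)) => hd; rewrite /= ?andbF // andbT.
  case E: (bounded_overpartition _ _ _ _) => //=.
  by apply: (@bounded_overpartition_notin l M n); rewrite bounded_overpartitionS E hd.
case: ltnP => Mn.
  apply: (@count_bounded_seqs_cons _ _ (M.+1, false)).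
  - by move=> s /andP[_ /andP[/bounded_overpartition_overpartition]].
  - by move=> s /andP[/bounded_overpartition_overpartition].
  case=> [|[x b] t] //=; rewrite xpair_eqE; case: eqP => //= ->.
  by rewrite underlined_overpartition_cons // Mn; case: b.
apply/eqP; rewrite -leqn0 leqNgt -has_count; apply/hasPn => -[|[x b] t] _ //=.
apply/andP=> -[/eqP->]; rewrite underlined_overpartition_cons //.
by rewrite leqNgt ltnS Mn andbF.
Qed.

(** A head equal to [M.+1] may be overlined or not, and either way the tail ranges over the same
    underlined overpartitions; hence the doubling. *)
Lemma num_boundedS l M n : ~~ (l %| M.+1) ->
  num_bounded l M.+1 n
  = num_bounded l M n
    + (if M < n then num_underlined l M.+1 (n - M.+1) else 0).*2.
Proof.
move=> lM; rewrite /num_bounded.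
rewrite -size_filter -(count_predC (fun s => head 0 (unzip1 s) == M.+1)).
rewrite addnC !count_filter; congr (_ + _).
  by apply: eq_count => s; rewrite [RHS]bounded_overpartitionS /= andbC.
case: ltnP => Mn; last first.
  apply/eqP; rewrite -leqn0 leqNgt -has_count; apply/hasPn => -[|[x b] t] _ //=.
  apply/andP=> -[/eqP->]; rewrite bounded_overpartition_cons //.
  by rewrite leqNgt ltnS Mn.
rewrite -size_filter -(count_predC (fun s => head false (unzip2 s))) !count_filter.
rewrite -addnn; congr (_ + _).
  apply: (@count_bounded_seqs_cons _ _ (M.+1, true)).
  - by move=> s /andP[_ /andP[_ /bounded_overpartition_overpartition]].
  - by move=> s /andP[/bounded_overpartition_overpartition].
  case=> [|[x b] t] //=; rewrite xpair_eqE; case: eqP => [->|]; rewrite ?andbF //=.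
  by rewrite bounded_overpartition_cons // Mn; case: b.
apply: (@count_bounded_seqs_cons _ _ (M.+1, false)).
- by move=> s /andP[_ /andP[_ /bounded_overpartition_overpartition]].
- by move=> s /andP[/bounded_overpartition_overpartition].
case=> [|[x b] t] //=; rewrite xpair_eqE; case: eqP => [->|]; rewrite ?andbF //=.
by rewrite bounded_overpartition_cons // Mn; case: b.
Qed.

Lemma num_boundedS_dvd l M n : l %| M.+1 ->
  num_bounded l M.+1 n = num_bounded l M n.
Proof.
move=> lM; apply: eq_count => s; rewrite [RHS]bounded_overpartitionS.
case: s => [|[x b] t] //=; first by rewrite andbT.
case: eqP => [->|]; rewrite ?andbT // andbF.
by rewrite /bounded_overpartition /is_regular_overpartition /= lM !(andbF, andFb).
Qed.

Lemma num_bounded0 l n : num_bounded l 0 n = (n == 0).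
Proof.
rewrite /num_bounded; case: n => [|n] /=.
  rewrite (@eq_count _ _ (pred1 [::])) ?count_uniq_mem ?bounded_seqs_uniq //.
    by rewrite mem_bounded_seqs.
  move=> [|[x b] t] //=; apply/andP=> -[/andP[/and4P[/= /andP[x0 _] _ _ _] _]].
  by rewrite leqNgt x0.
apply/eqP; rewrite -leqn0 leqNgt -has_count; apply/hasPn => -[|[x b] t] _ //=.
apply/andP=> -[/andP[/and4P[/= /andP[x0 _] _ _ _] _]].
by rewrite leqNgt x0.
Qed.

Lemma Abar_num_bounded l n : Abar l n = num_bounded l n n.
Proof.
rewrite /Abar /num_bounded cardsE cardE /enum_mem size_filter count_map enumT.
apply: eq_count => s; rewrite /= /bounded_overpartition unfold_in.
suff -> : all (fun p => p.1 <= n) (seq_of_bounded s) by rewrite andbT.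
by apply/allP => p /mapP[[x b] _ ->]; rewrite -ltnS ltn_ord.
Qed.

Local Open Scope ring_scope.

(** * A finite form of Gauss' identity *)

Section FiniteGauss.
Variables (R : comNzRingType) (q : R).

(* Up to a factor 2, the correction terms of the finite Gauss identity, with the
   summation index shifted by one; all of them are divisible by q^(n+1). *)
Definition shanks_term (n s : nat) : R :=
  (-1) ^+ s.+1 * (q ^+ n.+1) ^+ s.+1
  * (\prod_(s.+1 <= i < n) (1 - q ^+ i.+1) * \prod_(0 <= i < s) (1 + q ^+ i.+1)).

(** The sum of (-1)^k q^(k^2) over -n <= k <= n, with k and -k paired. *)
Definition theta (n : nat) : R :=
  1 + 2 * \sum_(0 <= j < n) (-1) ^+ j.+1 * q ^+ (j.+1 ^ 2).

(** The partial sums have a closed form, checked by induction on [k]. At [k = n] its first term is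
    the new theta term times the product of the 1 + q^i. *)
Lemma shanks_telescope n k : (k <= n)%N ->
  \sum_(0 <= s < k) (shanks_term n.+1 s - (1 + q ^+ n.+1) * shanks_term n s)
  = (-1) ^+ k.+1 * (q ^+ n.+1) ^+ k.+1
    * (\prod_(k <= i < n) (1 - q ^+ i.+1) * \prod_(0 <= i < k) (1 + q ^+ i.+1))
    + q ^+ n.+1 * \prod_(0 <= i < n) (1 - q ^+ i.+1).
Proof.
elim: k => [|k IH] lekn; first by rewrite !(big_geq (leqnn 0)); ring.
rewrite big_nat_recr //= IH ?(ltnW lekn) // /shanks_term.
rewrite (big_nat_recr n) //= (big_ltn lekn) (big_nat_recr k) //=.
rewrite [q ^+ n.+2]exprS [(q * _) ^+ k.+1]exprMn.
move: (\prod_(k.+1 <= i < n) _) (\prod_(0 <= i < n) _) (\prod_(0 <= i < k) _).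
move=> V U W; rewrite !(exprS _ k.+1).
move: (q ^+ n.+1) (q ^+ k.+1) ((-1) ^+ k.+1 : R) => y x e.
by move: (y ^+ k.+1) => z; ring.
Qed.

Lemma theta_shanks n :
  \prod_(0 <= i < n) (1 + q ^+ i.+1) * theta n
  = \prod_(0 <= i < n) (1 - q ^+ i.+1) + 2 * \sum_(0 <= s < n) shanks_term n s.
Proof.
rewrite /theta; elim: n => [|n IH]; first by rewrite !(big_geq (leqnn 0)); ring.
rewrite [X in _ = _ + 2 * X]big_nat_recr //=.
(* Telescoping trades the first [n] correction terms of level [n.+1] for those of level [n]; only
   the term [s = n], whose first product is empty, remains. *)
have := shanks_telescope (leqnn n); rewrite sumrB -mulr_sumr.
move/eqP; rewrite subr_eq => /eqP ->.
rewrite [shanks_term n.+1 n]/shanks_term !(big_geq (leqnn _)).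
rewrite !big_nat_recr //= [q ^+ n.+2]exprS [(q * _) ^+ n.+1]exprMn.
rewrite -[(n.+1 ^ 2)%N]mulnn exprM.
move: IH; move: (\prod_(0 <= i < n) (1 + _)) (\prod_(0 <= i < n) (1 - _)).
move=> O E.
move: (\sum_(0 <= j < n) _) (\sum_(0 <= j < n) _) => T S IH.
rewrite !exprS; move: (q * q ^+ n) ((-1) ^+ n : R) IH => y e IH.
rewrite [RHS]/=; move: (y ^+ n) (q ^+ n) => z x.
have -> : E = O * (1 + 2 * S) - 2 * T by rewrite IH addrK.
by ring.
Qed.
End FiniteGauss.

(** * Polynomials modulo a power of X *)

Section TruncatedCongruence.
Variables (F : fieldType) (N : nat).
Implicit Types p q r s : {poly F}.

(** Stated as divisibility, so that products and cancellation reduce to facts on [dvdp]; [eqXP]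
    gives the reading on coefficients. *)
Definition eqX p q : bool := dvdp 'X^(N.+1) (p - q).

Lemma eqXP p q : reflect (forall i, (i <= N)%N -> p`_i = q`_i) (eqX p q).
Proof.
apply: (iffP idP) => [/dvdpP[r E] i iN|E].
  by rewrite -[p](subrK q) E coefD coefMXn ltnS iN add0r.
rewrite /eqX -[p - q](poly_take_drop N.+1) dvdp_addl ?dvdp_mull //.
suff -> : take_poly N.+1 (p - q) = 0 by rewrite dvdp0.
apply/polyP => i; rewrite coef_take_poly coef0 coefB.
by case: ltnP => // iN; rewrite E ?subrr.
Qed.

Lemma eqX_refl p : eqX p p. Proof. by rewrite /eqX subrr dvdp0. Qed.

Lemma eqX_sym p q : eqX p q = eqX q p.
Proof. by rewrite /eqX -dvdpNr opprB. Qed.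

Lemma eqX_trans q p r : eqX p q -> eqX q r -> eqX p r.
Proof. by move=> pq qr; rewrite /eqX -(subrKA q) dvdp_add. Qed.

Lemma eqXM p q r s : eqX p q -> eqX r s -> eqX (p * r) (q * s).
Proof.
move=> pq rs; rewrite /eqX.
have -> : p * r - q * s = (p - q) * r + q * (r - s) by ring.
by apply: dvdp_add; [exact: dvdp_mulr | exact: dvdp_mull].
Qed.

Lemma eqX_exp n p q : eqX p q -> eqX (p ^+ n) (q ^+ n).
Proof.
by move=> pq; elim: n => [|n IH]; rewrite ?eqX_refl // !exprS eqXM.
Qed.

Lemma eqX_prod1 (I : Type) (t : seq I) (P : pred I) (f : I -> {poly F}) :
  (forall i, P i -> eqX (f i) 1) -> eqX (\prod_(i <- t | P i) f i) 1.
Proof.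
move=> f1; apply: (big_ind (eqX^~ 1)) => //; first exact: eqX_refl.
by move=> p q p1 q1; rewrite -[1]mulr1 eqXM.
Qed.

(** A nonzero constant term makes [p] coprime to X, hence to X^(N+1). *)
Lemma eqX_cancel p q r : p.[0] != 0 -> eqX (p * q) (p * r) -> eqX q r.
Proof.
move=> p0; rewrite /eqX -mulrBr Gauss_dvdpr //.
by rewrite coprimep_expl // -['X]subr0 -polyC0 coprimep_sym coprimep_XsubC.
Qed.

End TruncatedCongruence.

(** * Generating functions of overpartitions with bounded parts *)

Section GeneratingFunction.
Variables (F : fieldType) (N l : nat).

Definition gf_bounded M : {poly F} := \poly_(n < N.+1) (num_bounded l M n)%:R.
Definition gf_underlined M : {poly F} :=
  \poly_(n < N.+1) (num_underlined l M n)%:R.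

(** The two counting recurrences read C = A + C x and A1 = A + 2 C x modulo X^(N+1); eliminating C
    gives the claim. *)
Lemma gf_boundedS M : ~~ (l %| M.+1)%N ->
  eqX N (gf_bounded M.+1 * (1 - 'X^(M.+1))) (gf_bounded M * (1 + 'X^(M.+1))).
Proof.
move=> lM; set A1 := gf_bounded M.+1; set A := gf_bounded M.
set C := gf_underlined M.+1; set x := 'X^(M.+1).
have hC : eqX N C (A + C * x).
  apply/eqXP => i iN; rewrite coefD coefMXn !coef_poly !ltnS iN.
  rewrite num_underlinedS // natrD ltnNge; case: ltnP => // Mi.
  by rewrite (leq_trans (leq_subr _ _) iN).
have hA : eqX N A1 (A + 2 * (C * x)).
  apply/eqXP => i iN; rewrite coefD mulr_natl coefMn coefMXn !coef_poly !ltnS iN.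
  rewrite num_boundedS // natrD -muln2 natrM mulr_natr ltnNge; case: ltnP => // Mi.
  by rewrite (leq_trans (leq_subr _ _) iN).
rewrite /eqX.
have -> : A1 * (1 - x) - A * (1 + x)
  = (A1 - (A + 2 * (C * x))) * (1 - x) + 2 * x * (C - (A + C * x)) by ring.
by apply: dvdp_add; [exact: dvdp_mulr | exact: dvdp_mull].
Qed.

Lemma gf_boundedE M :
  eqX N (gf_bounded M * \prod_(0 <= i < M | ~~ (l %| i.+1)%N) (1 - 'X^(i.+1)))
        (\prod_(0 <= i < M | ~~ (l %| i.+1)%N) (1 + 'X^(i.+1))).
Proof.
elim: M => [|M IH].
  rewrite !big_geq // mulr1; apply/eqXP => i iN.
  by rewrite coef_poly ltnS iN num_bounded0 coef1.
rewrite ![\prod_(0 <= i < M.+1 | _) _]big_mkcond !big_nat_recr //= -!big_mkcond /=.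
have [lM|lM] := boolP (l %| M.+1)%N.
  suff -> : gf_bounded M.+1 = gf_bounded M by rewrite !mulr1.
  by apply/polyP => i; rewrite !coef_poly num_boundedS_dvd.
rewrite mulrA mulrAC; apply: eqX_trans (eqXM (gf_boundedS lM) (eqX_refl _ _)) _.
by rewrite mulrAC eqXM ?eqX_refl.
Qed.

End GeneratingFunction.

(** * The congruence modulo 5 *)

Section PowerOfProduct.
Variables (F : fieldType) (N p : nat) (f : nat -> {poly F}).
Hypotheses (p_gt0 : (0 < p)%N) (fX : forall k, f k ^+ p = f (p * k)%N)
  (f_big : forall k, (N < k)%N -> eqX N (f k) 1).

Lemma prod_multiples M :
  \prod_(0 <= i < M | (p %| i.+1)%N) f i.+1
  = \prod_(0 <= i < M %/ p) f (p * i.+1)%N.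
Proof.
elim: M => [|M IH]; first by rewrite div0n !big_geq.
rewrite big_mkcond big_nat_recr //= -big_mkcond IH /= (divnS _ p_gt0).
have [pM|_] := boolP (p %| M.+1)%N; last by rewrite add0n mulr1.
rewrite add1n big_nat_recr //=; congr (_ * f _).
have := divnS M p_gt0; rewrite pM add1n => <-.
by rewrite mulnC divnK.
Qed.

(** By [fX] the power is the product of the f(p k) for k <= N, and the factors with p k > N are 1
    modulo X^(N+1). *)
Lemma prod_exp_multiples :
  eqX N ((\prod_(0 <= i < N) f i.+1) ^+ p)
        (\prod_(0 <= i < N | (p %| i.+1)%N) f i.+1).
Proof.
rewrite prod_multiples -prodrXl (eq_bigr _ (fun i _ => fX i.+1)).
rewrite (big_cat_nat (leq0n (N %/ p)) (leq_div _ _)) /=.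
rewrite -[X in eqX _ _ X]mulr1 eqXM ?eqX_refl // big_nat_cond.
apply: eqX_prod1 => i; rewrite andbT => /andP[Ni _]; apply: f_big.
by rewrite mulnC -ltn_divLR.
Qed.

End PowerOfProduct.

(** Every [shanks_term] has the factor X^(N+1), so the finite identity loses its correction sum. *)
Lemma eqX_theta (F : fieldType) N :
  eqX N (\prod_(0 <= i < N) (1 + 'X^(i.+1)) * theta 'X N : {poly F})
        (\prod_(0 <= i < N) (1 - 'X^(i.+1))).
Proof.
rewrite theta_shanks /eqX addrAC subrr add0r dvdp_mull //.
apply: (big_ind (fun r => dvdp 'X^(N.+1) r)) => [|r s|i _]; first exact: dvdp0.
  exact: dvdp_add.
by apply: dvdp_mulr; apply: dvdp_mull; rewrite [_ ^+ i.+1]exprS dvdp_mulr.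
Qed.

(** The coefficient [c] serves both signs: 1 for O and -1 for E. *)
Lemma horner0_prod (F : fieldType) (N : nat) (c : {poly F}) :
  (\prod_(0 <= i < N) (1 + c * 'X^(i.+1))).[0] = 1.
Proof.
rewrite horner_prod big1 // => i _.
by rewrite hornerD hornerM hornerXn expr0n mulr0 addr0 hornerC.
Qed.

Lemma gf_bounded_theta N :
  eqX N (gf_bounded 'F_5 N 5 N) (theta 'X N ^+ 4).
Proof.
set A := gf_bounded _ _ _ _; set T := theta _ _.
pose E : {poly 'F_5} := \prod_(0 <= i < N) (1 - 'X^(i.+1)).
pose O : {poly 'F_5} := \prod_(0 <= i < N) (1 + 'X^(i.+1)).
have ch5 : 5%N \in [pchar {poly 'F_5}] by rewrite pchar_poly pchar_Fp.
have hE := @prod_exp_multiples _ N 5 (fun k => 1 - 'X^k : {poly 'F_5}) isT.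
have hO := @prod_exp_multiples _ N 5 (fun k => 1 + 'X^k : {poly 'F_5}) isT.
have {}hE : eqX N (E ^+ 5) (\prod_(0 <= i < N | (5 %| i.+1)%N) (1 - 'X^(i.+1))).
  apply: hE => k.
    by rewrite -(pFrobenius_autE ch5) rmorphB rmorph1 /= pFrobenius_autE -exprM mulnC.
  by move=> Nk; rewrite /eqX addrAC subrr add0r dvdpNr dvdp_exp2l.
have {}hO : eqX N (O ^+ 5) (\prod_(0 <= i < N | (5 %| i.+1)%N) (1 + 'X^(i.+1))).
  apply: hO => k.
    by rewrite -(pFrobenius_autE ch5) rmorphD rmorph1 /= pFrobenius_autE -exprM mulnC.
  by move=> Nk; rewrite /eqX addrAC subrr add0r dvdp_exp2l.
have hT : eqX N (O * T) E := eqX_theta _ N.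
have hA := gf_boundedE 'F_5 N 5 N; rewrite -/A in hA.
have split5 (f : nat -> {poly 'F_5}) : \prod_(0 <= i < N) f i
    = \prod_(0 <= i < N | (5 %| i.+1)%N) f i * \prod_(0 <= i < N | ~~ (5 %| i.+1)%N) f i.
  by rewrite (bigID (fun i => 5 %| i.+1)%N).
have defE : E = _ := split5 (fun i => 1 - 'X^(i.+1)).
have defO : O = _ := split5 (fun i => 1 + 'X^(i.+1)).
(* The four subproducts become opaque, so that [ring] handles them as variables. *)
move: hE hO hA defE defO => {split5}.
move: (\prod_(0 <= i < N | (5 %| i.+1)%N) (1 - _)).
move: (\prod_(0 <= i < N | (5 %| i.+1)%N) (1 + _)).
move: (\prod_(0 <= i < N | ~~ _) (1 - _)).
move: (\prod_(0 <= i < N | ~~ _) (1 + _)).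
move=> O' E' O'' E'' hE hO hA defE defO.
have E0 : E.[0] != 0.
  rewrite /E -(eq_bigr _ (fun i _ => congr1 (+%R 1) (mulN1r _))).
  by rewrite -[-1]polyCN horner0_prod oner_eq0.
have O0 : O.[0] != 0.
  rewrite /O -(eq_bigr _ (fun i _ => congr1 (+%R 1) (mul1r _))).
  by rewrite horner0_prod oner_eq0.
apply: (eqX_cancel (p := E * O ^+ 5)).
  by rewrite hornerM horner_exp mulf_neq0 ?expf_neq0.
(* Both sides, multiplied by E O^5, equal E^5 O. On the right this is O T = E; on the left, E O'' A
   = E'' O'' (A E') = E'' O'' O' = E'' O. *)
apply: (@eqX_trans _ _ (E ^+ 5 * O)); last first.
  have -> : E * O ^+ 5 * T ^+ 4 = (E * O) * (O * T) ^+ 4 by ring.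
  have -> : E ^+ 5 * O = (E * O) * E ^+ 4 by ring.
  by rewrite eqX_sym eqXM ?eqX_refl ?eqX_exp.
apply: (@eqX_trans _ _ (E * O'' * A)); first by rewrite !eqXM ?eqX_refl.
apply: (@eqX_trans _ _ (E'' * O)); last by rewrite eqX_sym eqXM ?eqX_refl.
rewrite defE {1}defO.
have -> : E'' * E' * O'' * A = E'' * O'' * (A * E') by ring.
by rewrite [X in eqX _ _ X]mulrA eqXM ?eqX_refl.
Qed.

(** * Powers of theta and sums of squares *)

Lemma sum_dist (R : nzRingType) (g : nat -> R) N :
  \sum_(x < (N + N).+1) g `|x - N|%N
  = g 0%N + 2 * \sum_(0 <= j < N) g j.+1.
Proof.
rewrite -(big_mkord predT (fun x => g `|x - N|%N)).
rewrite (big_cat_nat (leq0n N)) ?leqW ?leq_addr //= [\sum_(N <= i < _) _]big_ltn ?ltnS ?leq_addr //.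
rewrite distnn addrCA mulr_natl mulr2n; congr (_ + (_ + _)).
  (* The half below the centre [N] is reversed, to be indexed by the distance to [N]. *)
  rewrite big_nat_rev /=; apply: eq_big_nat => i iN; congr g; lia.
rewrite -{1}[N.+1]add0n big_addn subSS addnK.
by apply: eq_bigr => i _; congr g; lia.
Qed.

(** Since j and j^2 have the same parity, the sign is absorbed into a power of [- q]. *)
Lemma theta_sum (R : comNzRingType) (q : R) N :
  theta q N = \sum_(x < (N + N).+1) (- q) ^+ (`|x - N| ^ 2)%N.
Proof.
rewrite (sum_dist (fun d => (- q) ^+ (d ^ 2)%N)) /theta expr0; congr (_ + _ * _).
apply: eq_bigr => j _; rewrite [RHS]exprNn; congr (_ * _).
by rewrite -[LHS]signr_odd -[RHS]signr_odd oddX.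
Qed.

(** Expanding the power gives one monomial (-X)^(x_1^2 + ... + x_k^2) per point of the box
    [-N, N]^k, the very box in which [repr_squares] counts. *)
Lemma coef_theta_exp (R : comNzRingType) k N :
  (theta ('X : {poly R}) N ^+ k)`_N = (-1) ^+ N * (repr_squares k N)%:R.
Proof.
rewrite theta_sum -{1}(card_ord k) -prodr_const bigA_distr_bigA coef_sum.
rewrite /repr_squares cardsE -sum1_card natr_sum mulr_sumr [RHS]big_mkcond /=.
apply: eq_bigr => x _; rewrite -expr_sum (exprNn 'X).
set m := (\sum_i _)%N.
have -> : (x \in (fun x => is_square_repr N (shift_int x))) = (m == N).
  rewrite unfold_in /is_square_repr -eqz_nat /m (big_morph Posz PoszD erefl).
  congr (_ == _); apply: eq_bigr => i _.
  by rewrite ffunE -abszX gez0_abs // Num.Theory.sqr_ge0.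
rewrite -polyCN -polyC_exp coefCM coefXn eq_sym.
by case: eqP => [->|]; rewrite ?mulr0.
Qed.

Lemma eq_intr_Fp (p : nat) (m n : int) : prime p ->
  m%:~R = n%:~R :> 'F_p -> (m = n %[mod p%:Z])%Z.
Proof.
move=> pr_p mn; apply/eqP; rewrite eqz_mod_dvd dvdzE /= (dvdn_pcharf (pchar_Fp pr_p)).
have: (m - n)%:~R == 0 :> 'F_p by rewrite intrB mn subrr.
by case: (m - n) => d //=; rewrite NegzE rmorphN oppr_eq0.
Qed.

Theorem theorem1 (n : nat) (hn : (0 < n)%N) :
  ((Abar 5 n)%:Z = (-1) ^+ n * (repr_squares 4 n)%:Z %[mod 5%:Z])%Z.
Proof.
apply: eq_intr_Fp => //.
rewrite rmorphM rmorphXn rmorphN1 /= -!pmulrn -coef_theta_exp Abar_num_bounded.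
(* Truncating at order [n] itself suffices, as only the coefficient of X^n is compared. *)
have /eqXP/(_ n (leqnn n)) <- := gf_bounded_theta n.
by rewrite coef_poly ltnSn.
Qed.
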